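(* Let $X$ be an orthoset such that, for every subspace $A$ of $X$, the inclusion map $\iota \colon A \to X$, $a \mapsto a$, is adjointable (where $A$ carries the restriction of the orthogonality relation of $X$ and the same element $0$). Then: (i) $X$ is a Dacey space. (ii) If $X$ is atomistic, then the lattice $\mathsf{C}(X)$ has the covering property.
   Context: An orthoset (with $0$) is a non-empty set $X$ with a binary relation $\perp$ and a distinguished element $0$ such that: $x \perp y$ implies $y \perp x$; $x \perp x$ iff $x = 0$; $0 \perp x$ for all $x$. Elements $\neq 0$ are called proper. For $A \subseteq X$, $A^\perp = \{x \in X : x \perp y \text{ for all } y \in A\}$. A subset $A$ with $A = A^{\perp\perp}$ is called orthoclosed or a subspace; $\mathsf{C}(X)$ denotes the set of subspaces, a complete ortholattice under inclusion with orthocomplement $A \mapsto A^\perp$. Any subset containing $0$, with the restricted relation, is again an orthoset. A map $f \colon X \to Y$ between orthosets is adjointable if there is $g \colon Y \to X$ (an adjoint) with $f(x) \perp y \iff x \perp g(y)$ for all $x \in X$, $y \in Y$. $X$ is a Dacey space if $\mathsf{C}(X)$ is orthomodular. $X$ is atomistic if for any proper $x, y \in X$: whenever there is $z$ with $z \perp x$ and $z \not\perp y$, there is also $z'$ with $z' \perp y$ and $z' \not\perp x$. A lattice has the covering property if for every element $a$ and atom $p \not\le a$, $a \vee p$ covers $a$. *)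

(* Defs.v *)
From HB Require Import structures.
From mathcomp Require Import all_boot all_order.
From mathcomp Require Import boolp classical_sets.

Set Implicit Arguments.
Unset Strict Implicit.
Unset Printing Implicit Defensive.

Import Order.TTheory.
Local Open Scope classical_set_scope.

Record orthoset := Orthoset {
  orthoset_sort :> Type;
  orth : orthoset_sort -> orthoset_sort -> Prop;
  zero : orthoset_sort;
  orth_sym : forall x y, orth x y -> orth y x;
  orthxx : forall x, orth x x <-> x = zero;
  orth0x : forall x, orth zero x
}.
Arguments zero {o}.

Definition proper_elt (X : orthoset) (x : X) : Prop := x <> zero.

Definition atomistic (X : orthoset) : Prop :=
  forall x y : X, proper_elt x -> proper_elt y ->
    (exists z, orth z x /\ ~ orth z y) ->
    exists z', orth z' y /\ ~ orth z' x.

Definition adjointable (X Y : orthoset) (f : X -> Y) : Prop :=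
  exists g : Y -> X, forall x y, orth (f x) y <-> orth x (g y).

Section Restriction.
Context (X : orthoset) (A : set X) (A0 : A zero).

Definition restr_orth (a b : A) : Prop := orth (val a) (val b).
Definition restr_zero : A := exist _ zero (mem_set A0).

Lemma restr_orth_sym a b : restr_orth a b -> restr_orth b a.
Proof. exact: orth_sym. Qed.

Lemma restr_orthxx a : restr_orth a a <-> a = restr_zero.
Proof.
rewrite /restr_orth orthxx; split => [a0|-> //]; exact: val_inj.
Qed.

Lemma restr_orth0x a : restr_orth restr_zero a.
Proof. exact: orth0x. Qed.

Definition restr_orthoset : orthoset :=
  Orthoset restr_orth_sym restr_orthxx restr_orth0x.

Definition inclusion : restr_orthoset -> X := fun a : A => val a.

End Restriction.

Definition perp (X : orthoset) (A : set X) : set X :=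
  [set x | forall y, A y -> orth x y].

Definition orthoclosed (X : orthoset) (A : set X) : Prop := A = perp (perp A).

Record subspace (X : orthoset) := Subspace {
  subspace_set :> set X;
  subspaceP : orthoclosed subspace_set
}.

Section Perp.
Context (X : orthoset).
Implicit Types A B : set X.

Lemma perpS A B : A `<=` B -> perp B `<=` perp A.
Proof. by move=> AB x xB y /AB; exact: xB. Qed.

Lemma sub_perpK A : A `<=` perp (perp A).
Proof. by move=> x Ax y; move/(_ x Ax)/orth_sym. Qed.

Lemma perp_closed A : orthoclosed (perp A).
Proof.
apply/seteqP; split; first exact: sub_perpK.
exact/perpS/sub_perpK.
Qed.

Lemma perp0 A : perp A zero.
Proof. by move=> y _; exact: orth0x. Qed.

Lemma orth_setI A x : A x -> perp A x -> x = zero.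
Proof. by move=> Ax /(_ x Ax)/orthxx. Qed.

Lemma subspace0 (A : subspace X) : subspace_set A zero.
Proof. by rewrite (subspaceP A); exact: perp0. Qed.

Lemma subspace_inj : injective (@subspace_set X).
Proof.
move=> [A hA] [B hB] /= AB; case: _ / AB in hB *.
by congr Subspace; exact: Prop_irrelevance.
Qed.

End Perp.

HB.instance Definition _ (X : orthoset) := gen_eqMixin (subspace X).
HB.instance Definition _ (X : orthoset) := gen_choiceMixin (subspace X).

Section SubspaceOrder.
Context (X : orthoset).
Implicit Types A B C : subspace X.

Definition subspace_le A B : bool := `[< subspace_set A `<=` B >].

Lemma subspace_le_refl : reflexive subspace_le.
Proof. by move=> A; exact/asboolP. Qed.

Lemma subspace_le_anti : antisymmetric subspace_le.
Proof.
move=> A B /andP[/asboolP AB /asboolP BA].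
by apply: subspace_inj; apply/seteqP.
Qed.

Lemma subspace_le_trans : transitive subspace_le.
Proof.
by move=> B A C /asboolP AB /asboolP BC; apply/asboolP => x /AB /BC.
Qed.

Lemma meet_closed A B : orthoclosed (subspace_set A `&` B).
Proof.
apply/seteqP; split => [|x xAB]; first exact: sub_perpK.
split; rewrite (subspaceP (_ : subspace X)); move: x xAB.
- by apply/perpS/perpS => x [].
- by apply/perpS/perpS => x [].
Qed.

Definition subspace_meet A B : subspace X := Subspace (meet_closed A B).

Definition subspace_join A B : subspace X :=
  Subspace (perp_closed (perp (subspace_set A `|` B))).

Definition subspace_bot : subspace X := Subspace (perp_closed setT).
Definition subspace_top : subspace X := Subspace (perp_closed set0).
Definition subspace_perp A : subspace X := Subspace (perp_closed A).

Lemma subspace_meetP A B C :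
  subspace_le A (subspace_meet B C) = subspace_le A B && subspace_le A C.
Proof.
apply/asboolP/andP => [h|[/asboolP AB /asboolP AC] x Ax].
  by split; apply/asboolP => x /h [].
by split; [exact: AB|exact: AC].
Qed.

Lemma subspace_joinP A B C :
  subspace_le (subspace_join A B) C = subspace_le A C && subspace_le B C.
Proof.
apply/asboolP/andP => [h|[/asboolP AC /asboolP BC]].
  by split; apply/asboolP => x hx; apply/h/sub_perpK; [left|right].
rewrite (subspaceP C); apply/perpS/perpS => x [|].
- exact: AC.
- exact: BC.
Qed.

Lemma subspace_bot_le A : subspace_le subspace_bot A.
Proof.
apply/asboolP => x xT; rewrite (@orth_setI _ setT _ _ xT)//.
exact: subspace0.
Qed.

Lemma subspace_le_top A : subspace_le A subspace_top.
Proof. by apply/asboolP => x _ y []. Qed.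

End SubspaceOrder.

Fact subspace_display : Order.disp_t. Proof. exact: Order.Disp tt tt. Qed.

HB.instance Definition _ (X : orthoset) :=
  Order.Le_isPOrder.Build subspace_display (subspace X)
    (@subspace_le_refl X) (@subspace_le_anti X) (@subspace_le_trans X).
HB.instance Definition _ (X : orthoset) :=
  Order.POrder_MeetJoin_isLattice.Build subspace_display (subspace X)
    (@subspace_meetP X) (@subspace_joinP X).
HB.instance Definition _ (X : orthoset) :=
  Order.hasBottom.Build subspace_display (subspace X) (@subspace_bot_le X).
HB.instance Definition _ (X : orthoset) :=
  Order.hasTop.Build subspace_display (subspace X) (@subspace_le_top X).

HB.mixin Record TBLattice_hasOrthocompl (d : Order.disp_t) T
    of Order.TBLattice d T := {
  ocompl : T -> T;
  ocomplK : involutive ocompl;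
  le_ocompl : forall x y : T, (x <= y)%O -> (ocompl y <= ocompl x)%O;
  meetxO : forall x : T, (x `&` ocompl x = \bot)%O;
  joinxO : forall x : T, (x `|` ocompl x = \top)%O
}.

#[short(type="ortholatticeType")]
HB.structure Definition Ortholattice (d : Order.disp_t) :=
  { T of Order.TBLattice d T & TBLattice_hasOrthocompl d T }.

Section SubspaceOrtholattice.
Context (X : orthoset).
Implicit Types A B : subspace X.

Lemma subspace_perpK : involutive (@subspace_perp X).
Proof. by move=> A; apply: subspace_inj; exact/esym/subspaceP. Qed.

Lemma le_subspace_perp A B :
  (A <= B)%O -> (subspace_perp B <= subspace_perp A)%O.
Proof. by move/asboolP => AB; apply/asboolP/perpS. Qed.

Lemma meet_subspace_perp A : (A `&` subspace_perp A = \bot)%O.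
Proof.
apply/le_anti; rewrite le0x andbT; apply/asboolP => x [Ax].
by move/(orth_setI Ax) ->; exact: perp0.
Qed.

Lemma join_subspace_perp A : (A `|` subspace_perp A = \top)%O.
Proof.
apply/le_anti; rewrite lex1 /=; apply/asboolP => x _.
suff : subspace_set (subspace_join A (subspace_perp A)) x by [].
move=> y yA; have -> : y = zero.
  apply: (@orth_setI _ (perp A)).
    by apply: perpS yA => z Az; left.
  by apply: perpS yA => z Az; right.
exact/orth_sym/orth0x.
Qed.

End SubspaceOrtholattice.

HB.instance Definition _ (X : orthoset) :=
  TBLattice_hasOrthocompl.Build subspace_display (subspace X)
    (@subspace_perpK X) (@le_subspace_perp X)
    (@meet_subspace_perp X) (@join_subspace_perp X).

Definition orthomodular (d : Order.disp_t) (L : ortholatticeType d) : Prop :=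
  forall a b : L, (a <= b)%O -> (b = a `|` (b `&` ocompl a))%O.

(* b covers a; note the order of the arguments *)
Definition covers (d : Order.disp_t) (L : porderType d) (a b : L) : Prop :=
  (a < b)%O /\ ~ exists c : L, (a < c < b)%O.

Definition atom (d : Order.disp_t) (L : bLatticeType d) (p : L) : Prop :=
  covers \bot%O p.

Definition covering_property (d : Order.disp_t) (L : bLatticeType d) : Prop :=
  forall a p : L, atom p -> ~~ (p <= a)%O -> covers a (a `|` p)%O.

Definition Dacey (X : orthoset) : Prop := orthomodular (subspace X).

(* Main.v *)
(* Write [s] for the adjoint of the inclusion of a subspace [B]: every [b] in
   [B] is orthogonal to [x] iff it is orthogonal to [s x], so [s] plays the role
   of the projection onto [B].

   Dacey: if [A <= B] and [y] is orthogonal to [A] and to [B /\ A^perp], then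
   [s y] lies in [B /\ A^perp], hence is orthogonal to [y] and so to itself;
   thus [s y = 0] and [y] is orthogonal to [B].

   Covering property: let [x'] be the projection of [x] onto [A^perp].  Then
   [A \/ x = A \/ x'], and every vector of [(A \/ x) /\ A^perp] lies in
   [x'^perp^perp].  If [A < C <= A \/ x], orthomodularity yields a proper such
   vector [c] in [C], and atomisticity turns [c] in [x'^perp^perp] into [x'] in
   [c^perp^perp], so [C] contains both [A] and [x']. *)
From Pilot Require Import Defs.
From mathcomp Require Import all_boot all_order boolp classical_sets.

(* Imported again because [classical_sets] shadows [zero]. *)
Import Pilot.Defs Order.TTheory.
Local Open Scope classical_set_scope.

Set Implicit Arguments.
Unset Strict Implicit.

Section AdjointableInclusions.
Context (X : orthoset).
Hypothesis hX :
  forall A : subspace X, adjointable (@inclusion X A (subspace0 A)).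
Implicit Types A B C p : subspace X.

Lemma orthC (x y : X) : orth x y <-> orth y x.
Proof. by split; exact: orth_sym. Qed.

Lemma orthx0 (x : X) : orth x zero.
Proof. exact/orth_sym/orth0x. Qed.

Lemma subspace_projection A (x : X) :
  exists2 x', subspace_set A x' &
    forall a, subspace_set A a -> (orth a x <-> orth a x').
Proof.
have [g gP] := hX A; exists (val (g x)); first exact: set_mem (valP (g x)).
by move=> a Aa; exact: (gP (exist _ a (mem_set Aa)) x).
Qed.

Lemma subspace_orthomodular : Dacey X.
Proof.
move=> A B leAB; apply/le_anti/andP; split; last first.
  by rewrite leUx leAB leIl.
move/asboolP: leAB => leAB; apply/asboolP => b Bb.
suff : perp (perp (subspace_set A `|` (subspace_set B `&` perp A))) b by [].
move=> y yP; have [y' By' y'P] := subspace_projection B y.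
have y'A : perp A y'.
  move=> a Aa; apply/orthC; apply: (proj1 (y'P a (leAB a Aa))).
  by apply/orthC/yP; left.
have y'0 : y' = zero.
  by apply/orthxx/(y'P _ By')/orthC/yP; right.
by apply/(y'P b Bb); rewrite y'0; exact: orthx0.
Qed.

(** If some [z] orthogonal to [y] were not orthogonal to [x], atomisticity would give [z']
    orthogonal to [x] but not to [y], against [y] in x^perp^perp. *)
Lemma atomistic_perpperp_sym (x y : X) : atomistic X ->
  proper_elt y -> perp (perp [set x]) y -> perp (perp [set y]) x.
Proof.
move=> atX y0 yx z zy; apply: contrapT => nxz.
have x0 : proper_elt x by move=> x0; apply: nxz; rewrite x0; exact: orth0x.
have [|z' [z'x nz'y]] := atX y x y0 x0.
  by exists z; split; [exact: zy|by move/orth_sym].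
by apply/nz'y/orth_sym/yx => _ ->.
Qed.

Lemma subspace_nleP A B :
  ~~ (B <= A)%O -> exists2 x, subspace_set B x & ~ subspace_set A x.
Proof.
move=> /negP BA; apply: contrapT => nex.
by apply/BA/asboolP => x Bx; apply: contrapT => nAx; apply: nex; exists x.
Qed.

Definition line (x : X) : subspace X := Subspace (perp_closed (perp [set x])).

Lemma line_le (x : X) A : subspace_set A x -> (line x <= A)%O.
Proof.
move=> Ax; apply/asboolP; rewrite (subspaceP A).
by do 2!apply: perpS; move=> _ ->.
Qed.

Lemma line_id (x : X) : subspace_set (line x) x.
Proof. exact/sub_perpK. Qed.

(** A vector of [p] outside [A] is proper, so its line is a nonzero subspace of [p]; minimality of
    [p] forces equality. *)
Lemma atom_line A p : atom p -> ~~ (p <= A)%O ->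
  exists2 x, ~ subspace_set A x & p = line x.
Proof.
move=> [_ pmin] /subspace_nleP[x px nAx].
exists x => //; apply/eqP/negPn/negP => npx; apply: pmin.
exists (line x); apply/andP; split; last first.
  by rewrite lt_def npx line_le.
rewrite lt0x; apply/eqP => lx0; apply: nAx.
have : (line x <= A)%O by rewrite lx0 le0x.
by move/asboolP; apply; exact: line_id.
Qed.

Lemma perp_join_line A (x y : X) :
  perp (subspace_set (A `|` line x)%O) y <-> perp A y /\ orth y x.
Proof.
split=> [yP|[yA yx] z].
  split=> [a Aa|]; apply: yP; apply: sub_perpK; first by left.
  by right; exact: line_id.
by move/(_ y) => zP; apply/orthC/zP => w [/yA//|wx]; apply/orthC/wx => _ ->.
Qed.

Lemma le_join_line A C (x : X) : atomistic X ->
  (A < C)%O -> (C <= A `|` line x)%O -> (A `|` line x <= C)%O.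
Proof.
move=> atX AC /asboolP CAx.
have [x' x'A x'P] := subspace_projection (subspace_perp A) x.
have [c Cc [cA c0]] : exists2 c, subspace_set C c & perp A c /\ proper_elt c.
  (* Otherwise [C] meets A^perp only in [zero], and orthomodularity gives [C <= A]. *)
  apply: contrapT => nex.
  move: (AC); rewrite lt_leAnge => /andP[_ /negP]; apply.
  rewrite (subspace_orthomodular (ltW AC)) leUx lexx /=.
  apply/asboolP => z [Cz zA]; have [->|z0] := pselect (z = zero).
    exact: subspace0.
  by exfalso; apply: nex; exists z.
have cx' : perp (perp [set x']) c.
  (* Since [c] lies in A^perp, [z] may be replaced by its projection [z'], which is orthogonal to
     both [A] and [x]. *)
  move=> z zx'; have [z' z'A z'P] := subspace_projection (subspace_perp A) z.
  apply/(z'P c cA); have := CAx c Cc.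
  rewrite (subspaceP (A `|` line x)%O); apply; apply/perp_join_line.
  by split=> //; apply/(x'P _ z'A)/orthC/(z'P _ x'A)/orthC/zx'.
have Cx' : subspace_set C x'.
  have /asboolP := line_le Cc; apply.
  exact: atomistic_perpperp_sym cx'.
apply/asboolP; rewrite (subspaceP C) (subspaceP (A `|` line x)%O).
apply: perpS => y yC.
have yA : perp (subspace_set A) y.
  by apply: perpS yC; have /asboolP := ltW AC; exact.
(* On A^perp, being orthogonal to [x] and to [x'] coincide. *)
by apply/perp_join_line; split=> //; apply/(x'P _ yA)/yC.
Qed.

End AdjointableInclusions.

Theorem theorem4p10 (X : orthoset)
  (hX : forall A : subspace X, adjointable (@inclusion X A (subspace0 A))) :
  Dacey X /\ (atomistic X -> covering_property (subspace X)).
Proof.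
split; first exact: subspace_orthomodular.
move=> atX A p pat pA; have [x nAx px] := atom_line pat pA.
split; first by rewrite lt_neqAle leUl andbT eq_sym eq_joinl.
move=> [C /andP[AC CAp]]; have := CAp.
rewrite lt_leAnge px => /andP[CAx /negP]; apply.
exact: le_join_line.
Qed.
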